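(* Let $L>0$, $T>0$, and let $n:=\min\{m\in\mathbb{N} : T\le mL\}$. For all $w\in L^2(\Sigma)$ and for each choice of the sign $\pm$, $$\left|\left(\left(\pm\tfrac12\mathsf{Id}+\mathsf{K}\right)w,\,w\right)_{L^2(\Sigma)}\right|\;\ge\; c_s(n)\,\|w\|_{L^2(\Sigma)}^2,\qquad c_s(n):=\sin^2\!\left(\frac{\pi}{2(n+1)}\right).$$
   Context: Here $\Gamma=\{0,L\}$ is the boundary of the interval $(0,L)$, and $\Sigma=\Gamma\times[0,T]$ is the lateral boundary of the space-time cylinder $(0,L)\times(0,T)$. A function on $\Sigma$ is a pair $w=(w(0,\cdot),w(L,\cdot))$ of functions on $(0,T)$, and $L^2(\Sigma)=L^2(0,T)\times L^2(0,T)$ with inner product $(v,w)_{L^2(\Sigma)}=\int_0^T v(0,t)w(0,t)\,dt+\int_0^T v(L,t)w(L,t)\,dt$. $\mathsf{Id}$ is the identity. $\mathsf{K}$ is the double layer boundary integral operator of the one-dimensional wave equation, given explicitly by $$\mathsf{K}v(0,t)=-\tfrac12 v(L,t-L),\qquad \mathsf{K}v(L,t)=-\tfrac12 v(0,t-L),$$ where functions on $\Sigma$ are extended by zero to times $t\le 0$. *)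

(* Defs.v *)
From HB Require Import structures.
From mathcomp Require Import all_boot all_order all_algebra.
From mathcomp Require Import all_classical all_reals all_analysis.

Set Implicit Arguments.
Unset Strict Implicit.
Unset Printing Implicit Defensive.

Import Order.TTheory GRing.Theory Num.Theory.
Import numFieldNormedType.Exports.

Local Open Scope classical_set_scope.
Local Open Scope ring_scope.

(* A function w on {0, L} x (0, T) is the pair (w(0, .), w(L, .)); only the
   values at times in ]0, T[ matter, and elements of L^2 are handled through
   representatives. *)
Definition sigma_fun (R : realType) : Type := ((R -> R) * (R -> R))%type.

(* The restriction [f \_ D] is f on D and 0 outside D. *)
Definition L2_sigma (R : realType) (T : R) : set (sigma_fun R) :=
  [set w | (w.1 \_ `]0, T[ : R -> R) \in Lfun lebesgue_measure 2%:E /\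
           (w.2 \_ `]0, T[ : R -> R) \in Lfun lebesgue_measure 2%:E].

Definition inner_sigma (R : realType) (T : R) (v w : sigma_fun R) : R :=
  \int[lebesgue_measure]_(t in `]0, T[) (v.1 t * w.1 t) +
  \int[lebesgue_measure]_(t in `]0, T[) (v.2 t * w.2 t).

Definition norm_sigma (R : realType) (T : R) (w : sigma_fun R) : R :=
  Num.sqrt (inner_sigma T w w).

Definition ext0 (R : realType) (f : R -> R) : R -> R := f \_ `]0, +oo[.

Definition double_layer (R : realType) (L : R) (v : sigma_fun R) :
    sigma_fun R :=
  (fun t => - (1 / 2) * ext0 v.2 (t - L), fun t => - (1 / 2) * ext0 v.1 (t - L)).

(* The sign is + for b = false and - for b = true. *)
Definition half_id_plus_K (R : realType) (L : R) (b : bool) (w : sigma_fun R) :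
    sigma_fun R :=
  ((-1) ^+ b / 2) *: w + double_layer L w.

Lemma exists_mul_ge (R : realType) (L T : R) :
  0 < L -> exists m : nat, T <= m%:R * L.
Proof.
move=> L0; exists (Num.bound `|T / L|); rewrite -ler_pdivrMr//.
exact: le_trans (ler_norm _) (ltW (archi_boundP (normr_ge0 _))).
Qed.

Definition num_slices (R : realType) (L T : R) (hL : 0 < L) : nat :=
  ex_minn (exists_mul_ge T hL).

Definition c_s (R : realType) (n : nat) : R :=
  sin (pi / (2 * (n%:R + 1))) ^+ 2.

(* Main.v *)
Require Import Defs.
From HB Require Import structures.
From mathcomp Require Import all_boot all_order all_algebra.
From mathcomp Require Import all_classical all_reals all_analysis.
From mathcomp Require Import measurable_realfun zify ring lra.

Set Implicit Arguments.
Unset Strict Implicit.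
Unset Printing Implicit Defensive.

Import Order.TTheory GRing.Theory Num.Theory.
Import numFieldNormedType.Exports.

Local Open Scope classical_set_scope.
Local Open Scope ring_scope.

(** Write [f], [g] for the two components of [w], extended by zero outside
    [`]0, T[], and put [theta = pi / (n + 1)], [N = \int f^2 + \int g^2].  Then
    twice the quadratic form of [+-Id/2 + K] at [w] is [+-N - X], where
    [X = \int g(t - L) f(t) + \int f(t - L) g(t)].  Since
    [2 c_s n = 1 - cos theta], the theorem reduces to [|X| <= cos theta * N].

    Cut [`]0, T[] into the [n] slices [`[kL, (k+1)L[].  A time in slice [k] is
    coupled by [X] only to the corresponding times in slices [k - 1] and
    [k + 1], so [2 X] behaves like the quadratic form of the adjacency matrix of
    a path with [n] vertices.  The largest eigenvalue of that matrix is
    [2 cos theta], with the positive eigenvector of entries [s_1, ..., s_n],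
    where [s_j = sin (j theta)].  The bound by the Perron
    eigenvalue is obtained by weighted AM-GM (the Schur test): on slice [k] use
    the weights [rho = s_(k+2) / s_(k+1)] and [sigma = s_k / s_(k+1)].

    - The product of [rho] at [t - L] and [sigma] at [t] is [1], hence
      [2 |f(t - L) g(t)| <= rho(t - L) f(t - L)^2 + sigma(t) g(t)^2], and after
      translation [2 |\int f(t - L) g(t)| <= \int rho f^2 + \int sigma g^2]
      ([cross_term_le]).
    - The eigenvector equation says [rho + sigma = 2 cos theta]
      ([exists_step_weights]), so adding the bounds for the two cross terms
      gives [2 |X| <= 2 cos theta * N] ([shift_form_le]).

    The weights are functions of the integer part of [t / L], and no integral
    over an individual slice has to be considered. *)

(** * Translation invariance of the Lebesgue integral *)

Section translation.
Context {R : realType}.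
Local Notation mu := (@lebesgue_measure R).
Variable a : R.

Let shiftR : measurableTypeR R -> measurableTypeR R := fun t => t - a.

Let measurable_shiftR : measurable_fun [set: measurableTypeR R] shiftR.
Proof. exact: measurable_funB. Qed.

(** Both measures agree on half-open intervals, which determine a Borel measure
    on the line. *)
Lemma lebesgue_measure_shift (A : set R) : measurable A ->
  pushforward mu shiftR A = mu A.
Proof.
move=> mA; apply/esym/lebesgue_measure_unique => //= _ [[x y]] _ <-.
rewrite /pushforward.
have -> : shiftR @^-1` `]x, y] = `]x + a, y + a]%classic.
  by apply/seteqP; split=> t /=; rewrite !in_itv/= /shiftR ltrBrDr lerBlDr.
rewrite !lebesgue_measure_itv/= !lte_fin ltrD2r -!EFinB.
by rewrite opprD addrACA subrr addr0.
Qed.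

Lemma integrable_shift (f : R -> R) :
  mu.-integrable setT (EFin \o f) ->
  mu.-integrable setT (EFin \o (fun t => f (t - a))).
Proof.
move=> /integrableP[mf foo]; apply/integrableP; split.
  exact: (measurableT_comp mf measurable_shiftR).
rewrite -(ge0_integral_pushforward measurable_shiftR mu measurableT
  (f := fun t => `|(f t)%:E|%E))//; last exact: measurableT_comp.
rewrite (eq_measure_integral mu)// => A mA _.
exact: lebesgue_measure_shift.
Qed.

Lemma Rintegral_shift (f : R -> R) :
  mu.-integrable setT (EFin \o f) ->
  \int[mu]_t f (t - a) = \int[mu]_t f t.
Proof.
move=> intf; have [mf _] := integrableP _ _ _ intf.
rewrite /Rintegral; congr fine.
transitivity (\int[pushforward mu shiftR]_t (f t)%:E)%E.
  have /esym := integral_pushforward measurable_shiftR mf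
    (integrable_shift intf) measurableT.
  by rewrite preimage_setT.
by apply: eq_measure_integral => A mA _; exact: lebesgue_measure_shift.
Qed.

End translation.

(** * The Schur test for the translated product *)

Section schur_test.
Context {R : realType}.
Local Notation mu := (@lebesgue_measure R).

Lemma integrable_weighted_sqr (C : R) (D : set R) (rho f : R -> R) :
  measurable_fun setT rho -> (forall t, D t -> 0 <= rho t <= C) ->
  f \in Lfun mu 2%:E -> (forall t, ~ D t -> f t = 0) ->
  mu.-integrable setT (EFin \o (fun t => rho t * f t ^+ 2)).
Proof.
move=> mrho rhoC f2 fD.
have mf : measurable_fun setT f by case/andP: f2; rewrite inE.
apply: (@le_integrable _ _ _ mu _ measurableT _
  (fun t => C%:E * (f t ^+ 2)%:E)%E) => //.
- by apply/measurable_EFinP; apply: measurable_funM => //;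
    exact: measurable_funX.
- move=> t _ /=; rewrite lee_fin.
  have [/rhoC/andP[r0 rC]|/fD ->] := pselect (D t); last first.
    by rewrite expr0n !mulr0.
  rewrite !normrM ler_wpM2r// ger0_norm// ger0_norm//.
  exact: le_trans rC.
- by apply: integrableZl => //; exact: Lfun2_integrable_sqr.
Qed.

Lemma integrable_shift_mul (a : R) (f g : R -> R) :
  f \in Lfun mu 2%:E -> g \in Lfun mu 2%:E ->
  mu.-integrable setT (EFin \o (fun t => f (t - a) * g t)).
Proof.
move=> f2 g2.
have mf : measurable_fun setT f by case/andP: f2; rewrite inE.
have mg : measurable_fun setT g by case/andP: g2; rewrite inE.
have int_f2 := integrable_shift a (Lfun2_integrable_sqr f2).
have int_g2 := Lfun2_integrable_sqr g2.
apply: (le_integrable measurableT _ _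
  (integrableD measurableT int_f2 int_g2)) => //.
- apply/measurable_EFinP; apply: measurable_funM => //.
  by apply: (measurableT_comp mf); exact: measurable_funB.
- move=> t _ /=; rewrite lee_fin normrM.
  rewrite [leRHS]ger0_norm ?addr_ge0 ?sqr_ge0//.
  rewrite -real_normK ?num_real// -[g t ^+ 2]real_normK ?num_real//.
  have := normr_ge0 (f (t - a)); have := normr_ge0 (g t).
  by nra.
Qed.

Lemma weighted_AMGM (r s x y : R) : 0 <= r -> r * s = 1 ->
  2 * `|x * y| <= r * x ^+ 2 + s * y ^+ 2.
Proof.
rewrite le_eqVlt => /predU1P[<-|r0] rs.
  by move: rs => /eqP; rewrite mul0r eq_sym oner_eq0.
(* Multiplied by r, the difference of the two sides is (r |x| - |y|)^2. *)
rewrite -(ler_pM2l r0) mulrDr [r * (s * _)]mulrA rs mul1r normrM.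
rewrite -[x ^+ 2]real_normK ?num_real// -[y ^+ 2]real_normK ?num_real//.
by have := sqr_ge0 (r * `|x| - `|y|); lra.
Qed.

(** Weighted AM-GM holds pointwise wherever both [t - a] and [t] lie in [D], and
    elsewhere the product vanishes.  The bound [C] only serves to make the
    weighted integrals finite. *)
Lemma cross_term_le (a C : R) (D : set R) (rho sigma f g : R -> R) :
  measurable_fun setT rho -> measurable_fun setT sigma ->
  (forall t, D t -> 0 <= rho t <= C) -> (forall t, D t -> 0 <= sigma t <= C) ->
  (forall t, D (t - a) -> D t -> rho (t - a) * sigma t = 1) ->
  f \in Lfun mu 2%:E -> g \in Lfun mu 2%:E ->
  (forall t, ~ D t -> f t = 0) -> (forall t, ~ D t -> g t = 0) ->
  2 * `|\int[mu]_t (f (t - a) * g t)| <=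
  \int[mu]_t (rho t * f t ^+ 2) + \int[mu]_t (sigma t * g t ^+ 2).
Proof.
move=> mrho msigma rhoC sigmaC rho_sigma f2 g2 fD gD.
have ifg := integrable_shift_mul a f2 g2.
have irf := integrable_weighted_sqr mrho rhoC f2 fD.
have isg := integrable_weighted_sqr msigma sigmaC g2 gD.
have irfa := integrable_shift a irf.
rewrite -[X in _ <= X + _](Rintegral_shift a irf) -RintegralD//.
have inorm : mu.-integrable setT (EFin \o (fun t => `|f (t - a) * g t|)).
  exact: integrable_abse ifg.
apply: (@le_trans _ _ (2 * \int[mu]_t `|f (t - a) * g t|)).
  by rewrite ler_wpM2l// le_normr_Rintegral.
rewrite -RintegralZl//; apply: le_Rintegral => //.
- by have := integrableZl measurableT 2 inorm.
- by have := integrableD measurableT irfa isg.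
move=> t _.
have [Da|/fD fa] := pselect (D (t - a)); last first.
  rewrite fa mul0r normr0 mulr0 expr0n mulr0 add0r.
  have [/sigmaC/andP[s0 _]|/gD ->] := pselect (D t).
    by rewrite mulr_ge0// sqr_ge0.
  by rewrite expr0n mulr0.
have /andP[r0 _] := rhoC _ Da.
have [Dt|/gD gt] := pselect (D t); last first.
  by rewrite gt mulr0 normr0 mulr0 expr0n mulr0 addr0 mulr_ge0// sqr_ge0.
exact: weighted_AMGM (rho_sigma _ Da Dt).
Qed.

End schur_test.

(** * The Perron eigenvector of a path and its step weights *)

Section step_weights.
Context {R : realType}.
Variable n : nat.

Definition path_angle : R := pi / (n%:R + 1).

(** At [k = 1, ..., n] these are the coordinates of the Perron eigenvector of
    the path with [n] vertices; the values at [0] and [n + 1] vanish, which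
    encodes the boundary conditions. *)
Definition path_mode (k : int) : R := sin (k%:~R * path_angle).

Lemma path_mode_ge0 (k : int) : 0 <= k <= n%:Z + 1 -> 0 <= path_mode k.
Proof.
move=> /andP[k0 kn]; apply: sin_ge0_pi.
have n1 : 0 < n%:R + 1 :> R by rewrite ltr_wpDl.
have kn' : k%:~R <= n%:R + 1 :> R by rewrite -(ler_int R) intrD in kn.
rewrite /path_angle mulr_ge0 ?ler0z//=; last by rewrite divr_ge0 ?pi_ge0// ltW.
by rewrite mulrA ler_pdivrMr// mulrC ler_wpM2l ?pi_ge0.
Qed.

Lemma path_mode_gt0 (k : int) : 0 < k < n%:Z + 1 -> 0 < path_mode k.
Proof.
move=> /andP[k0 kn]; apply: sin_gt0_pi.
have n1 : 0 < n%:R + 1 :> R by rewrite ltr_wpDl.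
have kn' : k%:~R < n%:R + 1 :> R by rewrite -(ltr_int R) intrD in kn.
rewrite /path_angle mulr_gt0 ?ltr0z//=; last by rewrite divr_gt0 ?pi_gt0.
by rewrite mulrA ltr_pdivrMr// mulrC ltr_pM2l ?pi_gt0.
Qed.

Lemma path_mode_eigen (k : int) :
  path_mode (k + 2) + path_mode k = 2 * cos path_angle * path_mode (k + 1).
Proof.
rewrite /path_mode; set th := path_angle.
have -> : (k + 2)%:~R * th = (k + 1)%:~R * th + th by rewrite !intrD/=; ring.
have -> : k%:~R * th = (k + 1)%:~R * th - th by rewrite intrD/=; ring.
by rewrite sinB sinD; ring.
Qed.

(** The preimage of any set is a countable union of slices. *)
Lemma measurable_floor_div (c : int -> R) (L : R) : 0 < L ->
  measurable_fun setT (fun t : R => c (Num.floor (t / L))).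
Proof.
move=> L0 _ Y mY; rewrite setTI.
have -> : (fun t : R => c (Num.floor (t / L))) @^-1` Y = \bigcup_k
    (if c k \in Y then `[k%:~R * L, (k + 1)%:~R * L[%classic else set0).
  apply/seteqP; split=> t /=.
    move=> Yt; exists (Num.floor (t / L)) => //; rewrite mem_set//= in_itv/=.
    by rewrite -ler_pdivlMr// -ltr_pdivrMr// floor_itv.
  move=> [k _]; case: ifPn => //; rewrite inE => Yk /=.
  by rewrite in_itv/= -ler_pdivlMr// -ltr_pdivrMr// => /floor_def ->.
apply: countable_bigcupT_measurable => // k.
by case: ifP.
Qed.

Lemma floor_slice (L T t : R) : 0 < L -> T <= n%:R * L ->
  `]0, T[%classic t -> 0 <= Num.floor (t / L) < n%:Z.
Proof.
move=> L0 TnL /=; rewrite in_itv/= => /andP[t0 tT].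
rewrite floor_ge0 divr_ge0 1?ltW//= floor_lt_int ltr_pdivrMr//.
exact: lt_le_trans TnL.
Qed.

(** With [k] the index of the slice containing [t], take
    [rho t = s_(k+2) / s_(k+1)] and [sigma t = s_k / s_(k+1)], where
    [s = path_mode].  Since [t - L] lies in slice [k - 1], the product
    condition is a cancellation, and the sum condition is the eigenvector
    equation. *)
Lemma exists_step_weights (L T : R) :
  0 < L -> T <= n%:R * L ->
  exists rho sigma : R -> R,
    [/\ measurable_fun setT rho, measurable_fun setT sigma,
        forall t, `]0, T[%classic t ->
          [/\ 0 <= rho t, 0 <= sigma t & rho t + sigma t = 2 * cos path_angle] &
        forall t, `]0, T[%classic (t - L) -> `]0, T[%classic t ->
          rho (t - L) * sigma t = 1].
Proof.
move=> L0 TnL; pose s := path_mode.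
exists (fun t => s (Num.floor (t / L) + 2) / s (Num.floor (t / L) + 1)).
exists (fun t => s (Num.floor (t / L)) / s (Num.floor (t / L) + 1)).
split.
- exact: (measurable_floor_div (fun k => s (k + 2) / s (k + 1))).
- exact: (measurable_floor_div (fun k => s k / s (k + 1))).
- move=> t /(floor_slice L0 TnL); set k := Num.floor _ => k0n.
  have sk : 0 < s (k + 1) by apply: path_mode_gt0; lia.
  rewrite -mulrDl path_mode_eigen mulfK ?gt_eqF//; split => //.
    by rewrite divr_ge0 ?(ltW sk)// path_mode_ge0//; lia.
  by rewrite divr_ge0 ?(ltW sk)// path_mode_ge0//; lia.
- move=> t /(floor_slice L0 TnL) + /(floor_slice L0 TnL).
  have -> : Num.floor (t / L) = Num.floor ((t - L) / L) + 1.
    rewrite mulrBl divff ?gt_eqF// floorDrz ?rpredN ?rpred1//.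
    by rewrite floorN ?floor1 ?subrK.
  set k := Num.floor _ => k0n k1n; rewrite -addrA.
  by rewrite mulrA divfK ?divff// gt_eqF// path_mode_gt0//; lia.
Qed.

End step_weights.

(** * The lower bound for the quadratic form *)

(** The same weights serve both cross terms with [f] and [g] exchanged, so that
    each of [f^2] and [g^2] collects the full weight [rho + sigma]. *)
Lemma shift_form_le {R : realType} (L T : R) (n : nat) (f g : R -> R) :
  0 < L -> T <= n%:R * L ->
  f \in Lfun lebesgue_measure 2%:E -> g \in Lfun lebesgue_measure 2%:E ->
  (forall t, ~ `]0, T[%classic t -> f t = 0) ->
  (forall t, ~ `]0, T[%classic t -> g t = 0) ->
  `|\int[lebesgue_measure]_t (g (t - L) * f t) +
    \int[lebesgue_measure]_t (f (t - L) * g t)| <=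
  cos (path_angle n) * (\int[lebesgue_measure]_t (f t ^+ 2) +
                        \int[lebesgue_measure]_t (g t ^+ 2)).
Proof.
move=> L0 TnL f2 g2 fD gD.
have [rho [sigma [mrho msigma rsE rs1]]] := exists_step_weights L0 TnL.
set C := 2 * cos (path_angle n) in rsE.
have rhoC t : `]0, T[%classic t -> 0 <= rho t <= C.
  by move=> /rsE[r0 s0 <-]; rewrite r0 lerDl.
have sigmaC t : `]0, T[%classic t -> 0 <= sigma t <= C.
  by move=> /rsE[r0 s0 <-]; rewrite s0 lerDr.
have gf := cross_term_le mrho msigma rhoC sigmaC rs1 g2 f2 gD fD.
have fg := cross_term_le mrho msigma rhoC sigmaC rs1 f2 g2 fD gD.
have weights_add h : h \in Lfun lebesgue_measure 2%:E ->
    (forall t, ~ `]0, T[%classic t -> h t = 0) ->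
    \int[lebesgue_measure]_t (rho t * h t ^+ 2) +
    \int[lebesgue_measure]_t (sigma t * h t ^+ 2) =
    C * \int[lebesgue_measure]_t (h t ^+ 2).
  move=> h2 hD; rewrite -RintegralD//;
    [|exact: (integrable_weighted_sqr (C := C) (D := `]0, T[%classic))..].
  rewrite -RintegralZl//; last exact: Lfun2_integrable_sqr.
  apply: eq_Rintegral => t _ /=; rewrite -mulrDl.
  have [/rsE[_ _ ->]//|/hD ->] := pselect (`]0, T[%classic t).
  by rewrite expr0n !mulr0.
have wf := weights_add _ f2 fD; have wg := weights_add _ g2 gD.
rewrite /C in wf wg.
by apply: le_trans (ler_normD _ _) _; lra.
Qed.

Lemma c_sE {R : realType} (n : nat) : c_s R n = (1 - cos (path_angle n)) / 2.
Proof.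
rewrite /c_s.
have -> : path_angle n = (pi / (2 * (n%:R + 1))) *+ 2 :> R.
  rewrite /path_angle -mulr_natl; field.
  by rewrite gt_eqF// ltr_wpDl.
by rewrite cos_mulr2n cos2sin2; field.
Qed.

(** The contribution of one boundary point to the quadratic form.  For [t] in
    [`]0, T[] the time [t - L] is below [T], so extending [v] by zero to
    negative times only gives the same value at [t - L] as extending it by zero
    outside [`]0, T[]; this turns all integrals into integrals over the line. *)
Lemma half_component {R : realType} (L T e : R) (u v : R -> R) :
  let D := `]0, T[%classic in 0 < L ->
  u \_ D \in Lfun lebesgue_measure 2%:E ->
  v \_ D \in Lfun lebesgue_measure 2%:E ->
  \int[lebesgue_measure]_(t in D)
    ((e * u t + - (1 / 2) * ext0 v (t - L)) * u t) =
  e * \int[lebesgue_measure]_t ((u \_ D) t ^+ 2) -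
  1 / 2 * \int[lebesgue_measure]_t ((v \_ D) (t - L) * (u \_ D) t).
Proof.
move=> D L0 u2 v2; have iu2 := Lfun2_integrable_sqr u2.
have ivu := integrable_shift_mul L v2 u2.
rewrite -!RintegralZl// -RintegralB//; last 2 first.
- by have := integrableZl measurableT e iu2.
- by have := integrableZl measurableT (1 / 2) ivu.
rewrite Rintegral_mkcond; apply: eq_Rintegral => t _ /=.
rewrite !patchE /ext0 patchE; case: ifPn => [|_]; last first.
  by rewrite expr0n !mulr0 subrr.
rewrite inE /D/= in_itv/= => /andP[t0 tT].
have -> : (t - L \in `]0, +oo[%classic) = (t - L \in D).
  apply/idP/idP; rewrite !inE /D/= !in_itv/= ?andbT; last by case/andP.
  by move=> ->; rewrite (lt_trans _ tT)// ltrBlDr ltrDl.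
by case: ifP => _; ring.
Qed.

Theorem theorem3p2 (R : realType) (L T : R) (hL : 0 < L) (hT : 0 < T)
    (w : sigma_fun R) (hw : L2_sigma T w) (b : bool) :
  c_s R (num_slices T hL) * norm_sigma T w ^+ 2 <=
    `| inner_sigma T (half_id_plus_K L b w) w |.
Proof.
have TnL : T <= (num_slices T hL)%:R * L by rewrite /num_slices; case: ex_minnP.
set n := num_slices T hL in TnL *.
pose D := `]0, T[%classic : set R.
pose f := w.1 \_ D; pose g := w.2 \_ D.
have [f2 g2] :
    f \in Lfun lebesgue_measure 2%:E /\ g \in Lfun lebesgue_measure 2%:E.
  exact: hw.
have zero_off (h : R -> R) t : ~ D t -> (h \_ D) t = 0.
  by move=> Dt; rewrite patchE memNset.
pose N := \int[lebesgue_measure]_t (f t ^+ 2) +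
          \int[lebesgue_measure]_t (g t ^+ 2).
pose X := \int[lebesgue_measure]_t (g (t - L) * f t) +
          \int[lebesgue_measure]_t (f (t - L) * g t).
have XN : `|X| <= cos (path_angle n) * N.
  exact: (shift_form_le hL TnL f2 g2 (zero_off _) (zero_off _)).
have -> : inner_sigma T (half_id_plus_K L b w) w = ((-1) ^+ b * N - X) / 2.
  by rewrite /inner_sigma !half_component// /N /X; field.
have -> : norm_sigma T w ^+ 2 = N.
  rewrite /norm_sigma sqr_sqrtr /inner_sigma; last first.
    by rewrite addr_ge0// Rintegral_ge0// => t _; rewrite -expr2 sqr_ge0.
  congr (_ + _); rewrite Rintegral_mkcond; apply: eq_Rintegral => t _;
    by rewrite /f /g !patchE; case: ifP; rewrite ?expr0n ?expr2.
rewrite c_sE normrM [`|2^-1|]ger0_norm// mulrAC ler_wpM2r//.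
have N_sign : `|(-1) ^+ b * N| = `|N|.
  by rewrite normrM normrX normrN1 expr1n mul1r.
apply: le_trans (lerB_dist _ _); rewrite N_sign; have := ler_norm N; lra.
Qed.
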